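(* Let $q$ be a prime power, $m\ge 1$ an integer, and $k\in\{0,1,\ldots,m\}$. Let $n_k$ denote the number of $k$-normal elements of $\mathbb{F}_{q^m}$ over $\mathbb{F}_q$. If $n_k>0$, then $$n_k\ \ge\ \frac{\Phi_q(x^m-1)}{q^k}.$$
   Context: An element $\alpha\in\mathbb{F}_{q^m}$ is called $k$-normal over $\mathbb{F}_q$ if $\dim_{\mathbb{F}_q}\mathrm{span}_{\mathbb{F}_q}\{\alpha,\alpha^q,\ldots,\alpha^{q^{m-1}}\}=m-k$. For a polynomial $f\in\mathbb{F}_q[x]$ of positive degree, $\Phi_q(f)$ denotes the cardinality of the unit group $\left(\mathbb{F}_q[x]/\langle f\rangle\right)^{\times}$. *)

(* Defs.v *)
From HB Require Import structures.
From mathcomp Require Import all_boot all_order all_algebra all_fingroup all_field.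

Set Implicit Arguments.
Unset Strict Implicit.
Unset Printing Implicit Defensive.

Import GRing.Theory.
Local Open Scope ring_scope.

(* The equation dim = m - k is written additively to avoid the truncated
   subtraction of [nat]. *)
Definition k_normal (F : finFieldType) (L : fieldExtType F) (k : nat) (a : L) :
    bool :=
  let q := #|F| in
  let m : nat := \dim {:L} in
  let conjugates : seq L := [seq a ^+ (q ^ i) | i <- iota 0 m] in
  (\dim <<conjugates>>%VS + k == m)%N.

(* [finvect_type L] is [L] itself, carrying the [finType] structure that the
   abstract [L] lacks. *)
Definition num_k_normal (F : finFieldType) (L : fieldExtType F) (k : nat) :
    nat :=
  #|[set a : finvect_type L | @k_normal F L k a]|.

(* [{poly %/ h}] is the quotient by [h] only when [h] is monic of positive
   degree; the normalization by the leading coefficient, which does not change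
   the ideal, makes this the intended ring for every [f] of positive degree. *)
Definition Phi (F : finFieldType) (f : {poly F}) : nat :=
  #|[set: {unit {poly %/ (lead_coef f)^-1 *: f}}]|.

(* Main.v *)
Require Import Defs.
From HB Require Import structures.
From mathcomp Require Import all_boot all_order all_algebra all_fingroup all_field.
From mathcomp Require Import abelian.

Set Implicit Arguments.
Unset Strict Implicit.
Unset Printing Implicit Defensive.

Import GRing.Theory Num.Theory.
Local Open Scope ring_scope.

(** The polynomial [g] acts on [L] by [g . a = \sum_i g_i a^(q^i)], and
    [X^m - 1] acts as zero, so [L] is a module over [A = F[X]/(X^m - 1)] in which
    the span of the conjugates of [a] is the cyclic submodule [A a].
    Multiplying a [k]-normal [a] by a unit of [A] does not change [A a], so it
    gives another [k]-normal element.  Two units with the same product lie in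
    the same coset of [Ann a], which has [q^m / q^(m-k) = q^k] elements; hence
    the orbit of [a] has at least [Phi (X^m - 1) / q^k] elements. *)

Import FalgLfun.

Section PolynomialAction.

Variables (F : fieldType) (L : falgType F) (T : 'End(L)) (h : {poly F}).
Hypothesis hT0 : horner_alg T (mk_monic h) = 0.

Local Notation A := {poly %/ h}.

(** [A] is carried by this space of polynomials of bounded degree. With that vector space as domain,
    [limg] and [lker] give, under [hT0], the cyclic submodule of [a] and its annihilator. *)
Definition act_at (a : L) : 'Hom({poly_(size (mk_monic h)).-1 F}, L) :=
  linfun (fun p : {poly_(size (mk_monic h)).-1 F} =>
    horner_alg T (polyn p) a).

Lemma act_atE a (p : A) : act_at a p = horner_alg T (polyn p) a.
Proof.
have lin : linear (fun p : {poly_(size (mk_monic h)).-1 F} =>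
    horner_alg T (polyn p) a).
  by move=> c u v; rewrite !linearP /= add_lfunE mulr_algl scale_lfunE.
pose f : {linear _ -> _} := HB.pack
  (fun p : {poly_(size (mk_monic h)).-1 F} => horner_alg T (polyn p) a)
  (GRing.isLinear.Build _ _ _ _ _ lin).
by rewrite /act_at (lfunE f).
Qed.

(** The action descends to the quotient: the multiple of [mk_monic h] dropped by the division acts
    as zero by [hT0]. *)
Lemma horner_alg_rmodp (p : {poly F}) :
  horner_alg T (Pdiv.CommonRing.rmodp p (mk_monic h)) = horner_alg T p.
Proof.
rewrite [in RHS](Pdiv.RingMonic.rdivp_eq (monic_mk_monic h) p).
by rewrite rmorphD rmorphM /= hT0 mulr0 add0r.
Qed.

Lemma act_atM a (p u : A) : act_at a (p * u) = act_at (act_at a u) p.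
Proof.
rewrite !act_atE poly_of_qpolyM horner_alg_rmodp.
(* The product of ['End(L)] applies its left factor first, so the factors are swapped in the
   commutative polynomial ring. *)
by rewrite mulrC rmorphM /= lfun_mulE.
Qed.

Lemma act_at1 a : act_at a (1 : A) = a.
Proof. by rewrite act_atE /= rmorph1 id_lfunE. Qed.

Lemma limg_act_at_sub a (u : A) :
  (limg (act_at (act_at a u)) <= limg (act_at a))%VS.
Proof.
apply/subvP => _ /memv_imgP[p _ ->].
by rewrite -act_atM memv_img ?memvf.
Qed.

Lemma limg_act_at_unit a (u : A) : u \is a GRing.unit ->
  limg (act_at (act_at a u)) = limg (act_at a).
Proof.
move=> Uu; apply/eqP; rewrite eqEsubv limg_act_at_sub /=.
have {1}-> : a = act_at (act_at a u) u^-1 by rewrite -act_atM mulVr ?act_at1.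
exact: limg_act_at_sub.
Qed.

(** The monomials ['X^i] below the degree span the domain, and ['X^i] acts as [T ^+ i]. For the
    Frobenius map these generators are the conjugates of [a]. *)
Lemma limg_act_at a :
  limg (act_at a) =
  <<[seq (T ^+ i)%R a | i <- iota 0 (size (mk_monic h)).-1]>>%VS.
Proof.
rewrite -(span_basis (npolyX_full F _)) limg_span -map_comp -val_enum_ord.
rewrite -map_comp; congr (<<_>>%VS); apply: eq_map => i /=.
by rewrite act_atE npolypK ?size_polyXn // rmorphXn /= horner_algX.
Qed.

End PolynomialAction.

Section UnitOrbits.

Variables (F : finFieldType) (L : falgType F) (T : 'End(L)) (h : {poly F}).

Local Notation A := {poly %/ h}.

Lemma card_fiber_act_at a b :
  (#|[set u : A | act_at T h a u == b]| <= #|F| ^ \dim (lker (act_at T h a)))%N.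
Proof.
have [->|/set0Pn[u0]] := eqVneq [set u : A | act_at T h a u == b] set0.
  by rewrite cards0.
rewrite inE => /eqP u0b.
(* Subtracting [u0] embeds the fibre in the kernel. *)
rewrite -(card_vspace (lker (act_at T h a))) -(card_imset _ (@subIr _ u0)).
apply/subset_leq_card/subsetP => _ /imsetP[u + ->].
by rewrite inE memv_ker linearB /= u0b => /eqP->; rewrite subrr.
Qed.

Lemma card_units_le_orbit (S : {set finvect_type L}) a :
    (forall u : A, u \is a GRing.unit -> act_at T h a u \in S) ->
  (#|[set: {unit A}]| <= #|S| * #|F| ^ \dim (lker (act_at T h a)))%N.
Proof.
move=> unitS; rewrite -sum_nat_const -sum1_card.
rewrite (partition_big
  (fun u : {unit A} => act_at T h a (val u) : finvect_type L) (mem S)) /=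
  => [|u _]; last exact/unitS/(valP u).
apply: leq_sum => b _; rewrite sum1_card.
apply: leq_trans (card_fiber_act_at a b).
rewrite -(card_image val_inj); apply/subset_leq_card/subsetP.
by move=> _ /imageP[u + ->]; rewrite inE => /andP[_].
Qed.

End UnitOrbits.

Section Frobenius.

Variables (F : finFieldType) (L : fieldExtType F).

Lemma Frobenius_linear : linear (fun x : L => x ^+ #|F|).
Proof.
move=> c x y; have [p p_pr pF] := finPcharP F.
have pL : p \in [pchar L] by rewrite (pchar_lalg L).
(* Additivity needs [#|F|] to be a power of [p], which holds because the additive group of [F] is an
   elementary abelian [p]-group. *)
rewrite exprDn_pchar; last first.
  rewrite (eq_pnat _ (pcharf_eq pL)) -cardsT.
  exact/abelem_pgroup/(fin_ring_pchar_abelem pF).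
by rewrite exprZn expf_card.
Qed.

Definition Frobenius : 'End(L) :=
  linfun (HB.pack_for {linear L -> L} (fun x : L => x ^+ #|F|)
    (GRing.isLinear.Build _ _ _ _ _ Frobenius_linear)).

Lemma FrobeniusX i x : (Frobenius ^+ i) x = x ^+ (#|F| ^ i).
Proof.
elim: i => [|i IHi]; first by rewrite expr0 id_lfunE expr1.
by rewrite exprSr lfun_mulE IHi lfunE /= -exprM -expnSr.
Qed.

Lemma horner_alg_Frobenius : horner_alg Frobenius ('X^(\dim {:L}) - 1) = 0.
Proof.
rewrite rmorphB rmorph1 rmorphXn /= horner_algX; apply/eqP; rewrite subr_eq0.
apply/eqP/lfunP => x; rewrite FrobeniusX id_lfunE.
by apply/eqP; rewrite -Fermat's_little_theorem memvf.
Qed.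

End Frobenius.

Lemma mk_monic_monic (R : nzSemiRingType) (h : {poly R}) :
  (1 < size h)%N -> h \is monic -> mk_monic h = h.
Proof. by rewrite /mk_monic => -> ->. Qed.

Theorem theorem4 (q m k : nat) (F : finFieldType) (L : fieldExtType F)
    (hq : #|F| = q) (hm : \dim {:L} = m) (hk : (k <= m)%N)
    (hpos : (0 < num_k_normal L k)%N) :
  (Phi ('X^m - 1 : {poly F}))%:R / (q ^ k)%:R <= (num_k_normal L k)%:R :> rat.
Proof.
have m_gt0 : (0 < m)%N by rewrite -hm adim_gt0.
have h_monic : ('X^m - 1 : {poly F}) \is monic by rewrite monicXnsubC.
rewrite ler_pdivrMr; last by rewrite ltr0n expn_gt0 -hq (cardD1 0).
rewrite -natrM ler_nat /Phi (monicP h_monic) invr1 scale1r.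
(* As [m] is positive, [h] is monic and nonconstant, so [mk_monic] does not fall back on its default
   ['X]. *)
set h := 'X^m - 1; have hE : mk_monic h = h.
  by rewrite mk_monic_monic // size_XnsubC.
have sz_h : (size (mk_monic h)).-1 = m by rewrite hE size_XnsubC.
pose T := Frobenius L.
have hT0 : horner_alg T (mk_monic h) = 0.
  by rewrite hE /h -hm horner_alg_Frobenius.
have k_normalE a : k_normal k a = (\dim (limg (act_at T h a)) + k == m)%N.
  rewrite /k_normal hm limg_act_at sz_h.
  by rewrite (eq_map (fun i => FrobeniusX i a)).
case/card_gt0P: hpos => a; rewrite inE k_normalE => /eqP a_normal.
(* Rank-nullity on a domain of dimension [m], with image of dimension [m - k] by the choice of
   [a]. *)
have ker_dim : \dim (lker (act_at T h a)) = k.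
  apply/(@addIn (\dim (limg (act_at T h a)))).
  rewrite [RHS]addnC a_normal.
  by have := limg_ker_dim (act_at T h a) fullv; rewrite capfv dim_polyn => ->.
rewrite -hq -{2}ker_dim /num_k_normal; apply: card_units_le_orbit => u Uu.
by rewrite (@in_set (finvect_type L)) k_normalE limg_act_at_unit // a_normal.
Qed.
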